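(* Let $(M,g)$ be the Hayward black hole spacetime with parameters $m$ (mass) and $b$ (length-scale): in spherical coordinates $(x^1,x^2,x^3,x^4)=(t,r,\theta,\phi)$, $g=-\frac{B}{B_1}dt^2+\frac{B_1}{B}dr^2+r^2(d\theta^2+\sin^2\theta\, d\phi^2)$, where $B=2b^2m+r^2(r-2m)$ and $B_1=2b^2m+r^3$. Put $B_2=4b^2m-r^3$. Let $T^{EM}=\frac1\nu\left[S-\frac{\kappa}{2}g+\Lambda g\right]$ be the energy momentum tensor, where $\Lambda$ is the cosmological constant and $\nu=\frac{8\pi G}{c^4}$ ($G$ Newton's gravitational constant, $c$ the speed of light in vacuum). Then: (i) $R\cdot T^{EM}=-\frac{mB_2}{B_1^2}Q(g,T^{EM})$, i.e. the nature of the energy momentum tensor is pseudosymmetric; (ii) $C\cdot T^{EM}=-\frac{mr^3B_2}{B_1^3}Q(g,T^{EM})$; (iii) $W\cdot T^{EM}=-\frac{mr^3B_2}{B_1^3}Q(g,T^{EM})$; (iv) $K\cdot T^{EM}=\frac{mB_2^2}{B_1^3}Q(g,T^{EM})$; (v) $T^{EM}$ is Riemann compatible, projective compatible, conharmonic compatible, concircular compatible and conformal compatible, i.e. it is $T$-compatible for $T=R,P,K,W,C$ respectively.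
   Context: Conventions ($n=\dim M=4$). Curvature: $R$ is the $(0,4)$ Riemann curvature tensor, the Ricci tensor is $S_{q\mu}=g^{p\nu}R_{pq\mu\nu}$ and the scalar curvature is $\kappa=g^{q\mu}S_{q\mu}$; the overall sign of $R$ is fixed by the following component values for the present metric: $R_{3434}=\frac{2mr^4\sin^2\theta}{B_1}$, $S_{33}=-\frac{12b^2m^2r^2}{B_1^2}$, $\kappa=\frac{24b^2m^2(r^3-4b^2m)}{B_1^3}$. Kulkarni–Nomizu product of symmetric $(0,2)$-tensors: $(A\wedge U)_{pq\mu\nu}=A_{p\nu}U_{q\mu}-A_{p\mu}U_{q\nu}+A_{q\mu}U_{p\nu}-A_{q\nu}U_{p\mu}$. Curvature tensors of type $(0,4)$: conformal $C=R-\frac1{n-2}g\wedge S+\frac{\kappa}{2(n-1)(n-2)}g\wedge g$; concircular $W=R-\frac{\kappa}{2n(n-1)}g\wedge g$; conharmonic $K=R-\frac{1}{n-2}g\wedge S$; projective $P_{pq\mu\nu}=R_{pq\mu\nu}-\frac1{n-1}(g_{p\nu}S_{q\mu}-g_{q\nu}S_{p\mu})$. For a $(0,4)$-tensor $T$ and a $(0,2)$-tensor $H$: $(T\cdot H)_{q_1q_2\nu\mu}=-g^{pr}[T_{\mu\nu q_1r}H_{pq_2}+T_{\mu\nu q_2r}H_{q_1p}]$, and $Q(g,H)_{q_1q_2\nu\mu}=g_{\mu q_1}H_{\nu q_2}+g_{\mu q_2}H_{q_1\nu}-g_{\nu q_1}H_{\mu q_2}-g_{\nu q_2}H_{q_1\mu}$.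 A $(0,2)$-tensor $Z$, with corresponding endomorphism $\mathcal Z$ given by $g(\mathcal ZX,Y)=Z(X,Y)$, is $T$-compatible (for a $(0,4)$-tensor $T$) if the cyclic sum over $X_1,X_2,X_3$ of $T(\mathcal ZX_1,X,X_2,X_3)$ vanishes for all vector fields $X,X_1,X_2,X_3$.
   Formalization: Projective compatibility is false if P(X1,X2,X3,X4) uses the slots of P_{pqμν} in order (e.g. m=b=r=1, Λ=0); the formal version takes T_{pqμν}=T(∂_μ,∂_ν,∂_q,∂_p), so X2, X3 fill the skew pair of P; R, C, W, K are unaffected. *)

(* Defs.v *)
From HB Require Import structures.
From mathcomp Require Import all_boot all_order all_algebra.
From mathcomp Require Import all_classical all_reals all_analysis.

Set Implicit Arguments.
Unset Strict Implicit.
Unset Printing Implicit Defensive.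

Import Order.TTheory GRing.Theory Num.Theory.
Import numFieldNormedType.Exports.

Local Open Scope classical_set_scope.
Local Open Scope ring_scope.

(* The manifold is an open set of coordinate points x : 'rV[R]_4.  The        *)
(* coordinates x^1, ..., x^4 are x 0 0, ..., x 0 3.  A (0,2)-tensor at a      *)
(* point is the matrix of its components in the coordinate frame, a           *)
(* (0,4)-tensor is the family of its components, a tensor field is a function *)
(* of the coordinate point.  Tangent vectors are row vectors of components.   *)
Definition tensor2 (R : realType) := 'M[R]_4.
Definition tensor4 (R : realType) := 'I_4 -> 'I_4 -> 'I_4 -> 'I_4 -> R.
Definition field2 (R : realType) := 'rV[R]_4 -> tensor2 R.
Definition field4 (R : realType) := 'rV[R]_4 -> tensor4 R.
Definition vfield (R : realType) := 'rV[R]_4 -> 'rV[R]_4.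

Section Curvature.
Variable R : realType.
Implicit Types (g S A H : tensor2 R) (T : tensor4 R) (x X Y : 'rV[R]_4).
Implicit Types (p q mu nu : 'I_4).

Definition pderiv (f : 'rV[R]_4 -> R) (i : 'I_4) (x : 'rV[R]_4) : R :=
  'D_(delta_mx 0 i) f x.

Definition christoffel (g : field2 R) (k i j : 'I_4) (x : 'rV[R]_4) : R :=
  2^-1 * \sum_(l < 4) invmx (g x) k l *
    (pderiv (fun y => g y j l) i x + pderiv (fun y => g y i l) j x
     - pderiv (fun y => g y i j) l x).

(* R^p_{q mu nu}, with R(d_mu, d_nu) d_q = R^p_{q mu nu} d_p and              *)
(* R(X, Y) = [nabla_X, nabla_Y] - nabla_[X, Y].  This sign gives              *)
(* R_{pqpq} > 0 on round spheres, hence R_{3434} = 2 m r^4 sin^2 theta / B1   *)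
(* for the Hayward metric.                                                    *)
Definition riemann_up (g : field2 R) (p q mu nu : 'I_4) (x : 'rV[R]_4) : R :=
  pderiv (christoffel g p nu q) mu x - pderiv (christoffel g p mu q) nu x
  + \sum_(l < 4) (christoffel g p mu l x * christoffel g l nu q x
                  - christoffel g p nu l x * christoffel g l mu q x).

Definition riemann (g : field2 R) : field4 R := fun x p q mu nu =>
  \sum_(l < 4) g x p l * riemann_up g l q mu nu x.

(* The contraction is over the outer indices of R_{pq mu nu}, so S and kappa  *)
(* are the opposites of the usual Ricci tensor and scalar curvature.          *)
Definition ricci (g : field2 R) : field2 R := fun x =>
  \matrix_(q, mu) \sum_(p < 4) \sum_(nu < 4)
    invmx (g x) p nu * riemann g x p q mu nu.

Definition scalar_curvature (g : field2 R) (x : 'rV[R]_4) : R :=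
  \sum_(q < 4) \sum_(mu < 4) invmx (g x) q mu * ricci g x q mu.

Definition kulkarni_nomizu A (U : tensor2 R) : tensor4 R := fun p q mu nu =>
  A p nu * U q mu - A p mu * U q nu + A q mu * U p nu - A q nu * U p mu.

Definition conformal (g : field2 R) : field4 R := fun x p q mu nu =>
  riemann g x p q mu nu
  - (4 - 2)^-1 * kulkarni_nomizu (g x) (ricci g x) p q mu nu
  + scalar_curvature g x / (2 * (4 - 1) * (4 - 2))
    * kulkarni_nomizu (g x) (g x) p q mu nu.

Definition concircular (g : field2 R) : field4 R := fun x p q mu nu =>
  riemann g x p q mu nu
  - scalar_curvature g x / (2 * 4 * (4 - 1))
    * kulkarni_nomizu (g x) (g x) p q mu nu.

Definition conharmonic (g : field2 R) : field4 R := fun x p q mu nu =>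
  riemann g x p q mu nu
  - (4 - 2)^-1 * kulkarni_nomizu (g x) (ricci g x) p q mu nu.

Definition projective (g : field2 R) : field4 R := fun x p q mu nu =>
  riemann g x p q mu nu
  - (4 - 1)^-1 * (g x p nu * ricci g x q mu - g x q nu * ricci g x p mu).

(* (T . H)_{q1 q2 nu mu} *)
Definition tensor_dot g T H : tensor4 R := fun q1 q2 nu mu =>
  - \sum_(p < 4) \sum_(r < 4) invmx g p r *
      (T mu nu q1 r * H p q2 + T mu nu q2 r * H q1 p).

(* Q(g, H)_{q1 q2 nu mu} *)
Definition tachibana g H : tensor4 R := fun q1 q2 nu mu =>
  g mu q1 * H nu q2 + g mu q2 * H q1 nu
  - g nu q1 * H mu q2 - g nu q2 * H q1 mu.

Definition eval2 H X Y : R := \sum_(i < 4) \sum_(j < 4) H i j * X 0 i * Y 0 j.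

(* The value T(X1, X2, X3, X4) in terms of the components T_{pq mu nu}, with  *)
(* the argument order T_{pq mu nu} = T(d_mu, d_nu, d_q, d_p).  For T = R this *)
(* is R(X1, X2, X3, X4) = g(R(X1, X2) X3, X4).  For R, C, W, K, which have    *)
(* the symmetries of a curvature tensor, the other usual order                *)
(* T_{pq mu nu} = T(d_p, d_q, d_mu, d_nu) only changes signs.  The order      *)
(* matters for the projective tensor, which is skew in p, q but not in        *)
(* mu, nu: here the cyclic sum in [compatible] pairs X2, X3 with the skew     *)
(* indices; with the other order it does not vanish, even for Z = g, unless   *)
(* S is a multiple of g.                                                      *)
Definition eval4 T (X1 X2 X3 X4 : 'rV[R]_4) : R :=
  \sum_(p < 4) \sum_(q < 4) \sum_(mu < 4) \sum_(nu < 4)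
    T p q mu nu * X1 0 mu * X2 0 nu * X3 0 q * X4 0 p.

(* See [eval2_endo] for the defining property g(ZX, Y) = Z(X, Y). *)
Definition endo g (Z : tensor2 R) X : 'rV[R]_4 := X *m Z *m invmx g.

Lemma eval2_mulmx H X Y : eval2 H X Y = (X *m H *m Y^T) 0 0.
Proof.
rewrite /eval2 mxE exchange_big; apply: eq_bigr => j _.
rewrite !mxE mulr_suml; apply: eq_bigr => i _.
by rewrite [H i j * _]mulrC.
Qed.

Lemma eval2_endo g (Z : tensor2 R) X Y :
  g \in unitmx -> eval2 g (endo g Z X) Y = eval2 Z X Y.
Proof. by move=> gU; rewrite !eval2_mulmx /endo mulmxKV. Qed.

(* Z is T-compatible on the region U of the manifold with metric g. *)
Definition compatible (U : set 'rV[R]_4) (g : field2 R) (T : field4 R)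
    (Z : field2 R) : Prop :=
  forall X X1 X2 X3 : vfield R, {in U, forall x,
    eval4 (T x) (endo (g x) (Z x) (X1 x)) (X x) (X2 x) (X3 x)
    + eval4 (T x) (endo (g x) (Z x) (X2 x)) (X x) (X3 x) (X1 x)
    + eval4 (T x) (endo (g x) (Z x) (X3 x)) (X x) (X1 x) (X2 x) = 0}.

Definition energy_momentum (g : field2 R) (Lambda nu : R) : field2 R := fun x =>
  nu^-1 *: (ricci g x - (scalar_curvature g x / 2) *: g x + Lambda *: g x).

Definition einstein_constant (G c : R) : R := 8 * pi * G / c ^+ 4.

End Curvature.

Section Hayward.
Variables (R : realType) (m b : R).

Definition hayward_B (r : R) : R := 2 * b ^+ 2 * m + r ^+ 2 * (r - 2 * m).
Definition hayward_B1 (r : R) : R := 2 * b ^+ 2 * m + r ^+ 3.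
Definition hayward_B2 (r : R) : R := 4 * b ^+ 2 * m - r ^+ 3.

Definition coord_r (x : 'rV[R]_4) : R := x 0 1.
Definition coord_theta (x : 'rV[R]_4) : R := x 0 2.

Definition hayward_metric : field2 R := fun x =>
  let r := coord_r x in
  diag_mx (\row_(i < 4)
    [:: - (hayward_B r / hayward_B1 r); hayward_B1 r / hayward_B r;
        r ^+ 2; r ^+ 2 * sin (coord_theta x) ^+ 2]`_i).

(* The points of the spherical chart where the metric is regular. *)
Definition hayward_domain : set 'rV[R]_4 :=
  [set x | [/\ 0 < coord_r x, 0 < coord_theta x < pi,
               hayward_B (coord_r x) != 0 & hayward_B1 (coord_r x) != 0]].

Lemma hayward_metric_unitmx x :
  hayward_domain x -> hayward_metric x \in unitmx.
Proof.
move=> [r0 /sin_gt0_pi s0 B0 B10].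
rewrite unitmxE det_diag unitfE; apply/prodf_neq0 => i _; rewrite mxE.
case: i => [[|[|[|[|//]]]] ?] /=.
- by rewrite oppr_eq0 mulf_neq0 // invr_neq0.
- by rewrite mulf_neq0 // invr_neq0.
- by rewrite expf_neq0 // gt_eqF.
- by rewrite mulf_neq0 // expf_neq0 // gt_eqF.
Qed.

End Hayward.

(* Main.v *)
(* Put f = B / B1. The metric is diagonal, and a computation of the Christoffel
   symbols of -f dt^2 + dr^2 / f + r^2 (dtheta^2 + sin^2 theta dphi^2) gives
   R_{pq mu nu} = K_pq (g_{p mu} g_{q nu} - g_{p nu} g_{q mu}), where
   K_pq = - f'' / 2 on the (t, r)-plane, - f' / (2 r) on the four mixed planes
   and (1 - f) / r^2 on the (theta, phi)-plane. Hence S = s_p g_pq with s_p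
   constant on {t, r} and on {theta, phi}, and C, W, K have the form of R with
   other coefficients u_pq.
   A tensor T of that form satisfies (T . H)_{q1 q2 nu mu} =
   - u_{mu nu} Q(g, H)_{q1 q2 nu mu}. For H = T^EM the right-hand side vanishes
   when both mu and nu lie in {t, r}, or both in {theta, phi}, so only the
   value of u on the mixed planes matters, and this value does not depend on
   the mixed plane. *)
Require Import Defs.
From mathcomp Require Import all_boot all_order all_algebra.
From mathcomp Require Import all_classical all_reals all_analysis.
From mathcomp Require Import ring.
Import Order.TTheory GRing.Theory Num.Theory.
Import numFieldNormedType.Exports.
Local Open Scope classical_set_scope.
Local Open Scope ring_scope.

(** * Finite index sets, inverses of diagonal matrices and partial derivatives *)

Lemma ord4_ind (P : 'I_4 -> Prop) :
  P 0 -> P 1 -> P 2 -> P 3 -> forall i, P i.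
Proof.
move=> P0 P1 P2 P3 [[|[|[|[|//]]]] i_lt].
- by rewrite (_ : Ordinal i_lt = 0) //; apply: val_inj.
- by rewrite (_ : Ordinal i_lt = 1) //; apply: val_inj.
- by rewrite (_ : Ordinal i_lt = 2) //; apply: val_inj.
- by rewrite (_ : Ordinal i_lt = 3) //; apply: val_inj.
Qed.

Lemma invmx_diag (F : fieldType) n (d : 'rV[F]_n) : (forall i, d 0 i != 0) ->
  invmx (diag_mx d) = diag_mx (\row_i (d 0 i)^-1).
Proof.
move=> d0.
have dK : diag_mx d *m diag_mx (\row_i (d 0 i)^-1) = 1%:M.
  rewrite mulmx_diag -diag_const_mx; congr diag_mx.
  by apply/rowP => i; rewrite !mxE divff.
have /mulmx1_unit[dU _] := dK.
by rewrite -[LHS]mulmx1 -dK mulKmx.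
Qed.

Lemma sum_ord4 (V : nmodType) (F : 'I_4 -> V) :
  \sum_(i < 4) F i = F 0 + F 1 + F 2 + F 3.
Proof.
rewrite !big_ord_recl big_ord0 addr0 !addrA.
by do !congr (_ + _); congr F; apply: val_inj.
Qed.

(** A shift along a basis vector moves at most one of [coord_r] and [coord_theta], so the difference
    quotient is that of a one-variable slice of [h], or is zero. *)
Lemma pderiv_coord (R : realType) (h : R -> R -> R) (d1 d2 : R)
    (x : 'rV[R]_4) (i : 'I_4) :
  is_derive (coord_r x) 1 (h ^~ (coord_theta x)) d1 ->
  is_derive (coord_theta x) 1 (h (coord_r x)) d2 ->
  pderiv (fun y => h (coord_r y) (coord_theta y)) i x = [:: 0; d1; d2; 0]`_i.
Proof.
move=> H1 H2.
pose F y := h (coord_r y) (coord_theta y).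
have shiftE j : (fun e => e^-1 *: ((F \o shift x) (e *: delta_mx 0 j) - F x)) =
    (fun e : R => e^-1 *: (h (e * (j == 1)%:R + coord_r x)
                             (e * (j == 2)%:R + coord_theta x) - F x)).
  apply/funext => e; rewrite /F /coord_r /coord_theta /= !mxE eqxx /=.
  by rewrite ![_ == j]eq_sym.
rewrite /pderiv /derive shiftE; move: i; apply: ord4_ind => /=.
- under eq_fun do rewrite !mulr0 !add0r subrr scaler0.
  exact: lim_cst.
- rewrite -(@derive_val _ _ _ _ _ _ _ H1) /derive /=.
  by under eq_fun do rewrite mulr0 add0r.
- rewrite -(@derive_val _ _ _ _ _ _ _ H2) /derive /=.
  by under eq_fun do rewrite mulr0 add0r.
- under eq_fun do rewrite !mulr0 !add0r subrr scaler0.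
  exact: lim_cst.
Qed.

(** * Pointwise algebra of curvature-like tensors over a diagonal metric *)

Section DiagonalCurvature.
Context {R : realType}.
Implicit Types (u : 'I_4 -> 'I_4 -> R) (T : tensor4 R) (H : tensor2 R).
Implicit Types (tau : 'I_4 -> R) (p q mu nu : 'I_4).
Variable d : 'rV[R]_4.
Hypothesis d_neq0 : forall i, d 0 i != 0.
Let g : tensor2 R := diag_mx d.

Lemma diag_sym p q : g p q = g q p.
Proof.
by rewrite !mxE; case: eqVneq => [->|]; rewrite ?eqxx // eq_sym => /negPf->.
Qed.

Lemma sum_invmx_diag (F : 'I_4 -> 'I_4 -> R) :
  \sum_(p < 4) \sum_(r < 4) invmx g p r * F p r = \sum_(p < 4) F p p / d 0 p.
Proof.
apply: eq_bigr => p _; rewrite invmx_diag // (bigD1 p) //=.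
rewrite big1 => [|r /negPf rp].
  by rewrite addr0 !mxE eqxx mulrC.
by rewrite !mxE eq_sym rp mul0r.
Qed.

Lemma sum_diag q (F : 'I_4 -> R) : \sum_(p < 4) g q p * F p = d 0 q * F q.
Proof.
rewrite (bigD1 q) //= big1 ?addr0 => [|p /negPf pq]; rewrite !mxE ?eqxx //.
by rewrite eq_sym pq mul0r.
Qed.

(** For symmetric [u] both terms share the factor [u p q]. The transposed [u q p] in the second term
    makes room for the projective tensor, whose coefficients are not symmetric. *)
Definition diag_curvature u : tensor4 R := fun p q mu nu =>
  u p q * (g p mu * g q nu) - u q p * (g p nu * g q mu).

Lemma diag_curvature_ricci u q mu :
  \sum_(p < 4) \sum_(nu < 4) invmx g p nu * diag_curvature u p q mu nu
  = - (\sum_(p < 4 | p != q) u q p) * g q mu.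
Proof.
rewrite sum_invmx_diag (bigD1 q) //= mulNr mulr_suml -sumrN.
rewrite /diag_curvature [g q q]mxE eqxx mulr1n.
(* For [p = q] the two products in [diag_curvature] coincide and cancel. *)
rewrite [X in X / _](_ : _ = 0) ?mul0r ?add0r; last by ring.
apply: eq_bigr => p /negPf pq; rewrite [g q p]mxE eq_sym pq mulr0n !mulr0 sub0r.
by rewrite [g p p]mxE eqxx mulr1n mulNr; congr -%R; field.
Qed.

Lemma tensor_dot_diag u T H q1 q2 nu mu : (forall p q, u p q = u q p) ->
  (forall p q mu nu, T p q mu nu = diag_curvature u p q mu nu) ->
  tensor_dot g T H q1 q2 nu mu = - u mu nu * tachibana g H q1 q2 nu mu.
Proof.
move=> u_sym TE; rewrite /tensor_dot mulNr; congr (- _).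
rewrite sum_invmx_diag.
(* Symmetry of [u] gives the common factor [u mu nu]; each inner sum is then [g] contracted with its
   inverse, which [sum_diag] collapses to one entry of [H]. *)
transitivity (u mu nu * (
  g mu q1 * (\sum_p g nu p * (H p q2 / d 0 p))
  - g nu q1 * (\sum_p g mu p * (H p q2 / d 0 p))
  + g mu q2 * (\sum_p g nu p * (H q1 p / d 0 p))
  - g nu q2 * (\sum_p g mu p * (H q1 p / d 0 p)))).
  rewrite !mulr_sumr -!sumrB -!big_split /= -sumrB mulr_sumr.
  apply: eq_bigr => p _; rewrite !TE /diag_curvature (u_sym nu mu); ring.
rewrite !sum_diag /tachibana.
have dK i a : d 0 i * (a / d 0 i) = a by rewrite mulrC divfK.
by rewrite !dK; ring.
Qed.

(** The products [g mu q1 * g nu q2] and [g mu q2 * g nu q1] both occur with the factor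
    [tau nu - tau mu]. *)
Lemma tachibana_diag_eq0 tau H q1 q2 nu mu :
  (forall p q, H p q = tau p * g p q) -> tau mu = tau nu ->
  tachibana g H q1 q2 nu mu = 0.
Proof.
move=> HE tau_eq.
have HE' p q : H p q = tau q * g p q.
  by rewrite HE mxE; case: eqVneq => [->//|_]; rewrite !mulr0n !mulr0.
rewrite /tachibana (HE nu) (HE mu) !HE' tau_eq.
by rewrite (diag_sym mu) (diag_sym mu) (diag_sym nu) (diag_sym nu); ring.
Qed.

(** This isolates what remains to be checked for each tensor: the value of [u] on planes that join
    different eigenspaces of [H]. *)
Lemma tensor_dot_pseudosymmetric u tau L T H q1 q2 nu mu :
  (forall p q, u p q = u q p) ->
  (forall p q mu nu, T p q mu nu = diag_curvature u p q mu nu) ->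
  (forall p q, H p q = tau p * g p q) ->
  (forall i j, tau i != tau j -> u i j = - L) ->
  tensor_dot g T H q1 q2 nu mu = L * tachibana g H q1 q2 nu mu.
Proof.
move=> u_sym TE HE uL; rewrite (@tensor_dot_diag u) //.
have [tau_eq|/uL ->] := eqVneq (tau mu) (tau nu); last by rewrite opprK.
by rewrite (@tachibana_diag_eq0 tau) // !mulr0.
Qed.

Lemma endo_diag tau H (X : 'rV[R]_4) p :
  (forall p q, H p q = tau p * g p q) -> endo g H X 0 p = tau p * X 0 p.
Proof.
move=> HE; rewrite /endo.
have -> : H = diag_mx (\row_i tau i) *m g.
  by apply/matrixP => i j; rewrite HE mul_diag_mx !mxE.
rewrite mulmxA mulmxK; first by rewrite mul_mx_diag !mxE mulrC.
by rewrite unitmxE det_diag unitfE; apply/prodf_neq0.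
Qed.

Lemma eval4_diag u T (Y Z X2 X3 : 'rV[R]_4) :
  (forall p q mu nu, T p q mu nu = diag_curvature u p q mu nu) ->
  eval4 T Y Z X2 X3 = \sum_(p < 4) \sum_(q < 4) u p q * d 0 p * d 0 q *
    (Y 0 p * Z 0 q * (X2 0 q * X3 0 p - X2 0 p * X3 0 q)).
Proof.
move=> TE; rewrite /eval4.
transitivity (\sum_(p < 4) \sum_(q < 4) (
   u p q * d 0 p * d 0 q * (Y 0 p * Z 0 q * X2 0 q * X3 0 p)
   - u q p * d 0 p * d 0 q * (Y 0 q * Z 0 p * X2 0 q * X3 0 p))).
  apply: eq_bigr => p _; apply: eq_bigr => q _.
  transitivity (X2 0 q * X3 0 p * (
    u p q * ((\sum_mu g p mu * Y 0 mu) * (\sum_nu g q nu * Z 0 nu))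
    - u q p * ((\sum_mu g q mu * Y 0 mu) * (\sum_nu g p nu * Z 0 nu))));
    last by rewrite !sum_diag; ring.
  rewrite !mulr_suml !mulr_sumr -sumrB mulr_sumr; apply: eq_bigr => mu _.
  rewrite !mulr_sumr -sumrB mulr_sumr; apply: eq_bigr => nu _.
  by rewrite TE /diag_curvature; ring.
under eq_bigr do rewrite sumrB.
(* Exchanging the names [p] and [q] in the second half turns [u q p] into [u p q], so both halves
   carry one coefficient without symmetry of [u]. *)
rewrite sumrB [X in _ - X]exchange_big /= -sumrB.
apply: eq_bigr => p _; rewrite -sumrB; apply: eq_bigr => q _; ring.
Qed.

(* After moving the eigenvalues of [H] onto one index, the cyclic sum cancels
   pointwise, whatever the coefficients [u]. *)
Lemma cyclic_diag u tau T H (X X1 X2 X3 : 'rV[R]_4) :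
  (forall p q mu nu, T p q mu nu = diag_curvature u p q mu nu) ->
  (forall p q, H p q = tau p * g p q) ->
  eval4 T (endo g H X1) X X2 X3 + eval4 T (endo g H X2) X X3 X1
    + eval4 T (endo g H X3) X X1 X2 = 0.
Proof.
move=> TE HE; rewrite !(@eval4_diag u) // -!big_split /=.
apply: big1 => p _; rewrite -!big_split /=; apply: big1 => q _.
rewrite !(endo_diag _ _ _ _ HE); ring.
Qed.
End DiagonalCurvature.

(** * Component tables for a static spherically symmetric metric with profile [f] *)

Section StaticMetric.
Context {R : realType}.
(* [f1] and [f2] stand for the first two derivatives of [f]. *)
Variables (f f1 f2 : R -> R).

(** With indices in [nat], case analysis makes the lookups reduce, and the component formulas become
    finite lists of identities. *)
Definition static_coef (k : nat) (r t : R) : R :=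
  [:: - f r; (f r)^-1; r ^+ 2; r ^+ 2 * sin t ^+ 2]`_k.

Definition static_metric : field2 R := fun x =>
  diag_mx (\row_i static_coef i (coord_r x) (coord_theta x)).

(* [d_i g_{kk}] *)
Definition static_coef_der (i k : nat) (r t : R) : R :=
  [:: 0;
      [:: - f1 r; - (f1 r / f r ^+ 2); 2 * r; 2 * r * sin t ^+ 2]`_k;
      [:: 0; 0; 0; 2 * r ^+ 2 * sin t * cos t]`_k;
      0]`_i.

Definition static_christoffel (k i j : nat) (r t : R) : R :=
  match (k, i, j) with
  | (0, 0, 1)%N | (0, 1, 0)%N => f1 r / f r / 2
  | (1, 0, 0)%N => f r * f1 r / 2
  | (1, 1, 1)%N => - (f1 r / f r / 2)
  | (1, 2, 2)%N => - (r * f r)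
  | (1, 3, 3)%N => - (r * f r * sin t ^+ 2)
  | (2, 1, 2)%N | (2, 2, 1)%N | (3, 1, 3)%N | (3, 3, 1)%N => r^-1
  | (2, 3, 3)%N => - (sin t * cos t)
  | (3, 2, 3)%N | (3, 3, 2)%N => cos t / sin t
  | _ => 0
  end.

Definition static_christoffel_dr (k i j : nat) (r t : R) : R :=
  match (k, i, j) with
  | (0, 0, 1)%N | (0, 1, 0)%N => (f2 r * f r - f1 r ^+ 2) / f r ^+ 2 / 2
  | (1, 0, 0)%N => (f1 r ^+ 2 + f r * f2 r) / 2
  | (1, 1, 1)%N => - ((f2 r * f r - f1 r ^+ 2) / f r ^+ 2 / 2)
  | (1, 2, 2)%N => - (f r + r * f1 r)
  | (1, 3, 3)%N => - ((f r + r * f1 r) * sin t ^+ 2)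
  | (2, 1, 2)%N | (2, 2, 1)%N | (3, 1, 3)%N | (3, 3, 1)%N => - r ^- 2
  | _ => 0
  end.

Definition static_christoffel_dt (k i j : nat) (r t : R) : R :=
  match (k, i, j) with
  | (1, 3, 3)%N => - (2 * r * f r * sin t * cos t)
  | (2, 3, 3)%N => sin t ^+ 2 - cos t ^+ 2
  | (3, 2, 3)%N | (3, 3, 2)%N => - sin t ^- 2
  | _ => 0
  end.

(* [d_l Gamma^k_{ij}] *)
Definition static_christoffel_der (l k i j : nat) (r t : R) : R :=
  [:: 0; static_christoffel_dr k i j r t;
         static_christoffel_dt k i j r t; 0]`_l.

(* The value at [i = j] is meaningless: it only ever multiplies [0]. *)
Definition static_sectional (i j : nat) (r : R) : R :=
  if (i < 2)%N then if (j < 2)%N then - (f2 r / 2) else - (f1 r / (2 * r))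
  else if (j < 2)%N then - (f1 r / (2 * r)) else (1 - f r) / r ^+ 2.

Section AtPoint.
Variables (r t : R).
Hypotheses (r0 : r != 0) (s0 : sin t != 0) (f0 : f r != 0).
Hypotheses (Df : is_derive r 1 f (f1 r)) (Df1 : is_derive r 1 f1 (f2 r)).

Lemma static_coef_dr k : (k < 4)%N ->
  is_derive r 1 (static_coef k ^~ t) (static_coef_der 1 k r t).
Proof.
have Vf := is_deriveV f0 Df.
move: k => [|[|[|[|//]]]] _; rewrite /static_coef /static_coef_der /=.
- exact: is_deriveN.
- by apply: is_derive_eq; rewrite /GRing.scale /=; field.
- by apply: is_derive_eq; rewrite /GRing.scale /=; ring.
- by apply: is_derive_eq; rewrite /GRing.scale /=; ring.
Qed.

Lemma static_coef_dt k : (k < 4)%N ->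
  is_derive t 1 (static_coef k r) (static_coef_der 2 k r t).
Proof.
move: k => [|[|[|[|//]]]] _; rewrite /static_coef /static_coef_der /=.
- exact: is_derive_cst.
- exact: is_derive_cst.
- exact: is_derive_cst.
- by apply: is_derive_eq; rewrite /GRing.scale /=; ring.
Qed.

Lemma static_christoffel_is_dr k i j :
  is_derive r 1 (static_christoffel k i j ^~ t)
    (static_christoffel_dr k i j r t).
Proof.
have Vf := is_deriveV f0 Df.
have Vr := is_deriveV r0 (is_derive_id r 1).
move: k i j => [|[|[|[|k]]]] [|[|[|[|i]]]] [|[|[|[|j]]]];
  rewrite /static_christoffel /static_christoffel_dr /=.
all: try exact: is_derive_cst.
all: by apply: is_derive_eq; rewrite /GRing.scale /=; field.
Qed.

Lemma static_christoffel_is_dt k i j :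
  is_derive t 1 (static_christoffel k i j r) (static_christoffel_dt k i j r t).
Proof.
have Vs := is_deriveV s0 (is_derive_sin t).
move: k i j => [|[|[|[|k]]]] [|[|[|[|i]]]] [|[|[|[|j]]]];
  rewrite /static_christoffel /static_christoffel_dt /=.
all: try exact: is_derive_cst.
all: apply: is_derive_eq; rewrite /GRing.scale /=.
- by ring.
(* The derivative of [cos t / sin t] has numerator [- (sin t ^+ 2 + cos t ^+ 2)], which the
   Pythagorean identity turns into [-1]. *)
all: by field: (cos2sin2 t).
Qed.

Lemma static_coef_neq0 k : (k < 4)%N -> static_coef k r t != 0.
Proof.
move: k => [|[|[|[|//]]]] _; rewrite /static_coef /=.
- by rewrite oppr_eq0.
- by rewrite invr_eq0.
- by rewrite expf_neq0.
- by rewrite mulf_neq0 ?expf_neq0.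
Qed.

(** The right-hand side is what [christoffel] gives for a diagonal metric, where only the summand
    [l = k] survives. *)
Lemma static_christoffelE k i j : (k < 4)%N -> (i < 4)%N -> (j < 4)%N ->
  static_christoffel k i j r t =
  2^-1 * ((static_coef k r t)^-1 *
    (static_coef_der i j r t *+ (j == k) + static_coef_der j i r t *+ (i == k)
     - static_coef_der k i r t *+ (i == j))).
Proof.
move: k i j => [|[|[|[|//]]]] [|[|[|[|//]]]] [|[|[|[|//]]]] _ _ _;
  rewrite /static_christoffel /static_coef /static_coef_der /=.
all: by field; rewrite ?r0 ?s0 ?f0.
Qed.

(** The left-hand side is the lowered [riemann] with its sum over [l] unrolled. Each of the 256
    cases is a rational identity in [r], [f r], [f1 r], [f2 r], [sin t] and [cos t], modulo the
    Pythagorean identity. *)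
Lemma static_riemann p q mu nu :
    (p < 4)%N -> (q < 4)%N -> (mu < 4)%N -> (nu < 4)%N ->
  let Gam k i j := static_christoffel k i j r t in
  let dGam l k i j := static_christoffel_der l k i j r t in
  static_coef p r t *
    (dGam mu p nu q - dGam nu p mu q
     + ((Gam p mu 0%N * Gam 0%N nu q - Gam p nu 0%N * Gam 0%N mu q)
     + (Gam p mu 1%N * Gam 1%N nu q - Gam p nu 1%N * Gam 1%N mu q)
     + (Gam p mu 2%N * Gam 2%N nu q - Gam p nu 2%N * Gam 2%N mu q)
     + (Gam p mu 3%N * Gam 3%N nu q - Gam p nu 3%N * Gam 3%N mu q)))
  = static_sectional p q r *
    ((static_coef p r t *+ (p == mu)) * (static_coef q r t *+ (q == nu))
     - (static_coef p r t *+ (p == nu)) * (static_coef q r t *+ (q == mu))).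
Proof.
move: p q mu nu => [|[|[|[|//]]]] [|[|[|[|//]]]] [|[|[|[|//]]]] [|[|[|[|//]]]]
  _ _ _ _.
all: rewrite /static_christoffel_der /static_christoffel /static_christoffel_dr
  /static_christoffel_dt /static_coef /static_sectional /=.
all: by field: (cos2sin2 t); rewrite ?r0 ?s0 ?f0.
Qed.
End AtPoint.
End StaticMetric.

(* The Ricci curvature with the sign of [ricci], so the trace of
   [- static_sectional]. *)
Definition static_ricci {R : realType} (f f1 f2 : R -> R) (i : nat) (r : R) :=
  if (i < 2)%N then f2 r / 2 + f1 r / r else f1 r / r - (1 - f r) / r ^+ 2.

Definition static_scalar {R : realType} (f f1 f2 : R -> R) (r : R) : R :=
  f2 r + 4 * f1 r / r - 2 * (1 - f r) / r ^+ 2.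

(** * From the tables to the curvature tensors of the metric *)

Section StaticCurvature.
Context {R : realType}.
Variables (f f1 f2 : R -> R) (U : set R).
Hypotheses (U_open : open U) (U_neq0 : forall r, U r -> r != 0).
Hypothesis f_neq0 : forall r, U r -> f r != 0.
Hypothesis Df : forall r, U r -> is_derive r 1 f (f1 r).
Hypothesis Df1 : forall r, U r -> is_derive r 1 f1 (f2 r).
Let g := static_metric f.

Definition static_domain : set 'rV[R]_4 :=
  [set x | U (coord_r x) /\ sin (coord_theta x) != 0].

(** Christoffel symbols get differentiated, so their closed form has to hold on a neighbourhood of
    the point. *)
Lemma static_domain_near x :
  static_domain x -> \forall y \near x, static_domain y.
Proof.
move=> [Ux sx].
have cr : {for x, continuous (@coord_r R)} by exact: coord_continuous.
have ct : {for x, continuous (sin \o @coord_theta R)}.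
  by apply: continuous_comp; [exact: coord_continuous | exact: continuous_sin].
near=> y; split; near: y.
  by apply: cr; apply: open_nbhs_nbhs.
by apply: (ct (fun s => s != 0)); apply: open_nbhs_nbhs; split=> //.
Unshelve. all: by end_near. Qed.

Lemma pderiv_static_metric x (i j l : 'I_4) : static_domain x ->
  pderiv (fun y => g y j l) i x =
  static_coef_der f f1 i j (coord_r x) (coord_theta x) *+ (j == l).
Proof.
move=> [Ux sx]; have [<-|/negPf jl] := eqVneq j l.
  rewrite (_ : (fun y => _) =
    fun y => static_coef f j (coord_r y) (coord_theta y)); last first.
    by apply/funext => y; rewrite !mxE eqxx.
  transitivity [:: 0; static_coef_der f f1 1 j (coord_r x) (coord_theta x);
      static_coef_der f f1 2 j (coord_r x) (coord_theta x); 0]`_i.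
    apply: pderiv_coord; last exact: static_coef_dt.
    by apply: static_coef_dr; auto.
  by move: i; apply: ord4_ind.
rewrite (_ : (fun y => _) = cst 0) /pderiv ?derive_cst //.
by apply/funext => y; rewrite !mxE jl.
Qed.

Lemma christoffel_static x (k i j : 'I_4) : static_domain x ->
  christoffel g k i j x =
  static_christoffel f f1 k i j (coord_r x) (coord_theta x).
Proof.
move=> Dx; have [Ux sx] := Dx.
rewrite /christoffel /g invmx_diag; last first.
  by move=> l; rewrite mxE; apply: static_coef_neq0; auto.
rewrite (bigD1 k) //= big1 => [|l /negPf lk]; last first.
  by rewrite !mxE eq_sym lk mul0r.
rewrite addr0 !mxE eqxx !pderiv_static_metric //.
by rewrite (@static_christoffelE _ _ f1); auto.
Qed.

Lemma pderiv_christoffel_static x (l k i j : 'I_4) : static_domain x ->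
  pderiv (christoffel g k i j) l x =
  static_christoffel_der f f1 f2 l k i j (coord_r x) (coord_theta x).
Proof.
move=> Dx; have [Ux sx] := Dx.
have E : \forall y \near x, christoffel g k i j y =
    static_christoffel f f1 k i j (coord_r y) (coord_theta y).
  apply: filterS (static_domain_near _ Dx) => y Dy.
  exact: christoffel_static.
rewrite /pderiv (near_eq_derive _ E).
apply: pderiv_coord; last exact: static_christoffel_is_dt.
by apply: static_christoffel_is_dr; auto.
Qed.

Lemma riemann_static x (p q mu nu : 'I_4) : static_domain x ->
  riemann g x p q mu nu =
  static_sectional f f1 f2 p q (coord_r x) *
  (g x p mu * g x q nu - g x p nu * g x q mu).
Proof.
move=> Dx; have [Ux sx] := Dx.
rewrite /riemann (bigD1 p) //= big1 => [|l /negPf lp]; last first.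
  by rewrite !mxE eq_sym lp mul0r.
rewrite addr0 /riemann_up sum_ord4 !christoffel_static //.
rewrite !pderiv_christoffel_static //.
rewrite !mxE eqxx.
have := @static_riemann _ f f1 f2 _ _ (U_neq0 _ Ux) sx (f_neq0 _ Ux) _ _ _ _
  (ltn_ord p) (ltn_ord q) (ltn_ord mu) (ltn_ord nu).
by rewrite !val_eqE /= => ->.
Qed.

Section AtPoint.
Variable x : 'rV[R]_4.
Hypothesis Dx : static_domain x.
Let r := coord_r x.
Let t := coord_theta x.
Let d : 'rV[R]_4 := \row_i static_coef f i r t.
Let K (p q : 'I_4) := static_sectional f f1 f2 p q r.
Let s (p : 'I_4) := static_ricci f f1 f2 p r.
Let kappa := static_scalar f f1 f2 r.

Lemma static_row_neq0 i : d 0 i != 0.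
Proof. by case: Dx => ? ?; rewrite mxE; apply: static_coef_neq0; auto. Qed.

Lemma static_sectional_sym p q : K p q = K q p.
Proof. by rewrite /K /static_sectional; case: ltnP; case: ltnP. Qed.

Lemma riemann_static_diag p q mu nu :
  riemann g x p q mu nu = diag_curvature d K p q mu nu.
Proof.
by rewrite riemann_static // /diag_curvature (static_sectional_sym q) mulrBr.
Qed.

Lemma ricci_static p q : ricci g x p q = s p * g x p q.
Proof.
rewrite mxE; under eq_bigr do under eq_bigr do rewrite riemann_static_diag.
rewrite (diag_curvature_ricci _ static_row_neq0) big_mkcond sum_ord4.
congr (_ * _); have [/U_neq0 r0 _] := Dx.
by move: p; apply: ord4_ind;
  rewrite /s /K /static_ricci /static_sectional /=; field.
Qed.

Lemma scalar_curvature_static : scalar_curvature g x = kappa.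
Proof.
rewrite /scalar_curvature (sum_invmx_diag _ static_row_neq0).
transitivity (\sum_p s p).
  apply: eq_bigr => p _; rewrite ricci_static.
  by rewrite [g x p p]mxE eqxx mulfK // static_row_neq0.
have [/U_neq0 r0 _] := Dx.
by rewrite sum_ord4 /s /kappa /static_ricci /static_scalar /=; field.
Qed.

(** Adding multiples of [g] and rescaling changes the eigenvalues of the Ricci tensor but keeps the
    coordinate eigenframe. *)
Lemma energy_momentum_static Lambda nu p q :
  energy_momentum g Lambda nu x p q =
  nu^-1 * (s p - kappa / 2 + Lambda) * g x p q.
Proof.
rewrite !mxE -/(g x) scalar_curvature_static -/(ricci g x) -/(g x p q).
have := ricci_static p q; rewrite !mxE => ->.
ring.
Qed.

(** As [S] is diagonal too, Kulkarni-Nomizu products only shift the coefficients: [g] with [S]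
    contributes [- (s i + s j)], and [g] with itself contributes [-2]. *)
Lemma conformal_static p q mu nu : conformal g x p q mu nu =
  diag_curvature d (fun i j => K i j + (s i + s j) / 2 - kappa / 6) p q mu nu.
Proof.
rewrite /conformal riemann_static_diag scalar_curvature_static.
rewrite /kulkarni_nomizu /diag_curvature !ricci_static -[diag_mx d]/(g x).
by rewrite (static_sectional_sym q); field.
Qed.

Lemma concircular_static p q mu nu : concircular g x p q mu nu =
  diag_curvature d (fun i j => K i j + kappa / 12) p q mu nu.
Proof.
rewrite /concircular riemann_static_diag scalar_curvature_static.
rewrite /kulkarni_nomizu /diag_curvature -[diag_mx d]/(g x).
by rewrite (static_sectional_sym q); field.
Qed.

Lemma conharmonic_static p q mu nu : conharmonic g x p q mu nu =
  diag_curvature d (fun i j => K i j + (s i + s j) / 2) p q mu nu.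
Proof.
rewrite /conharmonic riemann_static_diag.
rewrite /kulkarni_nomizu /diag_curvature !ricci_static -[diag_mx d]/(g x).
by rewrite (static_sectional_sym q); field.
Qed.

Lemma projective_static p q mu nu : projective g x p q mu nu =
  diag_curvature d (fun i j => K i j + s i / 3) p q mu nu.
Proof.
rewrite /projective riemann_static_diag.
rewrite /diag_curvature !ricci_static -[diag_mx d]/(g x).
by rewrite (static_sectional_sym q); field.
Qed.

Section EnergyMomentum.
Variables Lambda nu0 : R.
Let TEM := energy_momentum g Lambda nu0.

Lemma tensor_dot_static (u : 'I_4 -> 'I_4 -> R) (L : R) (T : tensor4 R)
    q1 q2 nu mu :
  (forall p q, u p q = u q p) ->
  (forall p q mu nu, T p q mu nu = diag_curvature d u p q mu nu) ->
  (forall p q : 'I_4, (p < 2 <= q)%N -> u p q = - L) ->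
  tensor_dot (g x) T (TEM x) q1 q2 nu mu =
  L * tachibana (g x) (TEM x) q1 q2 nu mu.
Proof.
move=> u_sym TE uL.
apply: (tensor_dot_pseudosymmetric _ static_row_neq0 _ _ _ _ _ _ _ _ _
  u_sym TE) => [p q|].
  exact: energy_momentum_static.
move=> i j; rewrite /s /static_ricci.
(* Within a block [static_ricci] is constant, so distinct eigenvalues force a mixed plane; symmetry
   of [u] handles the reversed order. *)
case: ltnP => i2; case: ltnP => j2; rewrite ?eqxx // => _.
  by rewrite uL ?i2.
by rewrite u_sym uL ?j2.
Qed.
End EnergyMomentum.
End AtPoint.

(** Compatibility is pointwise: the vector fields enter only through their values at [x]. Arbitrary
    [u] lets the projective tensor be treated like the others. *)
Lemma compatible_static (u : 'rV[R]_4 -> 'I_4 -> 'I_4 -> R) (T : field4 R)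
    (D : set 'rV[R]_4) Lambda nu0 : D `<=` static_domain ->
  (forall x, static_domain x -> forall p q mu nu, T x p q mu nu =
    diag_curvature (\row_i static_coef f i (coord_r x) (coord_theta x)) (u x)
      p q mu nu) ->
  compatible D g T (energy_momentum g Lambda nu0).
Proof.
move=> DS TE X X1 X2 X3 x /set_mem /DS Dx.
apply: (cyclic_diag _ (static_row_neq0 _ Dx) _ _ _ _ _ _ _ _ (TE x Dx)) => p q.
exact: (energy_momentum_static _ Dx).
Qed.

End StaticCurvature.

(** * The Hayward profile: derivatives and curvature coefficients *)

Section Hayward.
Context {R : realType}.
Variables m b : R.

Definition hayward_f (r : R) : R := hayward_B m b r / hayward_B1 m b r.

(** Since [B = B1 - 2 m r^2], the profile is [1 - 2 m r^2 / B1]; the factor [B2] arises as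
    [2 B1 - 3 r^3]. *)
Definition hayward_f1 (r : R) : R :=
  - (2 * m * r * hayward_B2 m b r / hayward_B1 m b r ^+ 2).

(** In the quotient rule, [4 b^2 m - 4 r^3] is the derivative of [r B2]. *)
Definition hayward_f2 (r : R) : R :=
  - (2 * m * ((4 * b ^+ 2 * m - 4 * r ^+ 3) * hayward_B1 m b r
       - 6 * r ^+ 3 * hayward_B2 m b r) / hayward_B1 m b r ^+ 3).

Definition hayward_radii : set R :=
  [set r | [/\ 0 < r, hayward_B m b r != 0 & hayward_B1 m b r != 0]].

Lemma hayward_metric_static : hayward_metric m b = static_metric hayward_f.
Proof.
apply/funext => x; congr diag_mx; apply/rowP; apply: ord4_ind;
  by rewrite !mxE /static_coef /hayward_f ?invf_div.
Qed.

Lemma hayward_B_derive (r : R) :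
  is_derive r 1 (hayward_B m b) (3 * r ^+ 2 - 4 * m * r).
Proof. by apply: is_derive_eq; rewrite /GRing.scale /=; ring. Qed.

Lemma hayward_B1_derive (r : R) : is_derive r 1 (hayward_B1 m b) (3 * r ^+ 2).
Proof. by apply: is_derive_eq; rewrite /GRing.scale /=; ring. Qed.

Lemma hayward_B2_derive (r : R) :
  is_derive r 1 (hayward_B2 m b) (- (3 * r ^+ 2)).
Proof. by apply: is_derive_eq; rewrite /GRing.scale /=; ring. Qed.

Lemma hayward_radii_open : open hayward_radii.
Proof.
have cts (h dh : R -> R) :
    (forall r : R, is_derive r 1 h (dh r)) -> continuous h.
  move=> H r; apply: differentiable_continuous; apply/derivable1_diffP.
  by case: (H r).
have opn (h dh : R -> R) : (forall r : R, is_derive r 1 h (dh r)) ->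
    open [set r | h r != 0].
  move=> /cts ch; apply: (@open_comp _ _ h [set y | y != 0]);
    last exact: open_neq.
  by move=> r _; exact: ch.
rewrite (_ : hayward_radii = [set r | 0 < r] `&`
  ([set r | hayward_B m b r != 0] `&` [set r | hayward_B1 m b r != 0]));
  last by apply/seteqP; split=> r /= []; [|move=> ? []].
apply: openI; first exact: open_gt.
apply: openI; first exact: opn hayward_B_derive.
exact: opn hayward_B1_derive.
Qed.

Lemma hayward_f_derive (r : R) :
  hayward_radii r -> is_derive r 1 hayward_f (hayward_f1 r).
Proof.
move=> [r0 B0 B10].
have DB := hayward_B_derive r.
have DV := is_deriveV B10 (hayward_B1_derive r).
apply: is_derive_eq; rewrite /GRing.scale /= /hayward_f1.
move: B10; rewrite /hayward_B /hayward_B1 /hayward_B2 => B10; by field.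
Qed.

Lemma hayward_f1_derive (r : R) :
  hayward_radii r -> is_derive r 1 hayward_f1 (hayward_f2 r).
Proof.
move=> [r0 B0 B10].
have DB := hayward_B2_derive r.
have DB1 := hayward_B1_derive r.
have DB1X : is_derive r 1 (fun s => hayward_B1 m b s ^+ 2)
    (2 * hayward_B1 m b r * (3 * r ^+ 2)).
  by apply: is_derive_eq; rewrite /GRing.scale /=; ring.
have DV := is_deriveV (f := fun s => hayward_B1 m b s ^+ 2)
  (expf_neq0 2 B10) DB1X.
apply: is_derive_eq; rewrite /GRing.scale /= /hayward_f2.
move: B10; rewrite /hayward_B1 /hayward_B2 => B10; by field.
Qed.

Lemma hayward_domain_static :
  hayward_domain m b `<=` static_domain hayward_radii.
Proof.
by move=> x [r0 /sin_gt0_pi s0 B0 B10]; split; [split | rewrite gt_eqF].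
Qed.

Lemma hayward_sectional_mixed (r : R) (i j : nat) :
  hayward_radii r -> (i < 2 <= j)%N ->
  static_sectional hayward_f hayward_f1 hayward_f2 i j r =
  m * hayward_B2 m b r / hayward_B1 m b r ^+ 2.
Proof.
move=> [/lt0r_neq0 r0 _ B10] /andP[i2]; rewrite leqNgt => /negPf j2.
by rewrite /static_sectional i2 j2 /hayward_f1; field; rewrite B10.
Qed.

Lemma hayward_scalar (r : R) : hayward_radii r ->
  static_scalar hayward_f hayward_f1 hayward_f2 r =
  24 * b ^+ 2 * m ^+ 2 * (r ^+ 3 - 4 * b ^+ 2 * m) / hayward_B1 m b r ^+ 3.
Proof.
move=> [/lt0r_neq0 r0 _].
rewrite /static_scalar /hayward_f2 /hayward_f1 /hayward_f.
rewrite /hayward_B /hayward_B2 /hayward_B1 => B10; field.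
by rewrite B10.
Qed.

(** Both Ricci eigenvalues are double, so this sum is [kappa / 2]. Hence on mixed planes the
    conformal shift [kappa / 4 - kappa / 6] equals the concircular shift [kappa / 12], and the
    factors for [C] and [W] agree. *)
Lemma hayward_ricci_mixed (r : R) (i j : nat) :
  hayward_radii r -> (i < 2 <= j)%N ->
  static_ricci hayward_f hayward_f1 hayward_f2 i r
    + static_ricci hayward_f hayward_f1 hayward_f2 j r =
  12 * b ^+ 2 * m ^+ 2 * (r ^+ 3 - 4 * b ^+ 2 * m) / hayward_B1 m b r ^+ 3.
Proof.
move=> [/lt0r_neq0 r0 _] + /andP[i2]; rewrite leqNgt => + /negPf j2.
rewrite /static_ricci i2 j2 /hayward_f2 /hayward_f1 /hayward_f.
rewrite /hayward_B /hayward_B2 /hayward_B1 => B10; field.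
by rewrite B10.
Qed.
End Hayward.

Theorem theorem4p1 (R : realType) (m b Lambda G c : R) (hG : 0 < G) (hc : 0 < c) :
  let g := hayward_metric m b in
  let D := hayward_domain m b in
  let TEM := energy_momentum g Lambda (einstein_constant G c) in
  let B1 := fun x => hayward_B1 m b (coord_r x) in
  let B2 := fun x => hayward_B2 m b (coord_r x) in
  [/\ {in D, forall x, forall q1 q2 nu mu : 'I_4,
        tensor_dot (g x) (riemann g x) (TEM x) q1 q2 nu mu
        = - (m * B2 x / B1 x ^+ 2) * tachibana (g x) (TEM x) q1 q2 nu mu},
      {in D, forall x, forall q1 q2 nu mu : 'I_4,
        tensor_dot (g x) (conformal g x) (TEM x) q1 q2 nu mu
        = - (m * coord_r x ^+ 3 * B2 x / B1 x ^+ 3)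
          * tachibana (g x) (TEM x) q1 q2 nu mu},
      {in D, forall x, forall q1 q2 nu mu : 'I_4,
        tensor_dot (g x) (concircular g x) (TEM x) q1 q2 nu mu
        = - (m * coord_r x ^+ 3 * B2 x / B1 x ^+ 3)
          * tachibana (g x) (TEM x) q1 q2 nu mu},
      {in D, forall x, forall q1 q2 nu mu : 'I_4,
        tensor_dot (g x) (conharmonic g x) (TEM x) q1 q2 nu mu
        = m * B2 x ^+ 2 / B1 x ^+ 3
          * tachibana (g x) (TEM x) q1 q2 nu mu}
    & [/\ compatible D g (riemann g) TEM,
          compatible D g (projective g) TEM,
          compatible D g (conharmonic g) TEM,
          compatible D g (concircular g) TEM
        & compatible D g (conformal g) TEM]].
Proof.
move=> g D TEM B1 B2.
have gE : g = static_metric (hayward_f m b) by exact: hayward_metric_static.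
have U_open := @hayward_radii_open R m b.
have U_neq0 (r : R) : hayward_radii m b r -> r != 0 by move=> [/lt0r_neq0].
have f_neq0 (r : R) : hayward_radii m b r -> hayward_f m b r != 0.
  by move=> [_ B0 B10]; rewrite mulf_neq0 ?invr_neq0.
have Df (r : R) : hayward_radii m b r ->
    is_derive r 1 (hayward_f m b) (hayward_f1 m b r)
  by exact: hayward_f_derive.
have Df1 (r : R) : hayward_radii m b r ->
    is_derive r 1 (hayward_f1 m b) (hayward_f2 m b r)
  by exact: hayward_f1_derive.
have DS : D `<=` static_domain (hayward_radii m b).
  exact: hayward_domain_static.
have dot := @tensor_dot_static R _ _ _ _ U_open U_neq0 f_neq0 Df Df1.
have compat := @compatible_static R _ _ _ _ U_open U_neq0 f_neq0 Df Df1.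
have riemE := @riemann_static_diag R _ _ _ _ U_open U_neq0 f_neq0 Df Df1.
have confE := @conformal_static R _ _ _ _ U_open U_neq0 f_neq0 Df Df1.
have concE := @concircular_static R _ _ _ _ U_open U_neq0 f_neq0 Df Df1.
have conhE := @conharmonic_static R _ _ _ _ U_open U_neq0 f_neq0 Df Df1.
have projE := @projective_static R _ _ _ _ U_open U_neq0 f_neq0 Df Df1.
have B1_neq0 (r : R) : hayward_radii m b r ->
    2 * b ^+ 2 * m + r ^+ 3 != 0 by move=> [].
rewrite /TEM !gE; split.
- move=> x /set_mem /DS Dx q1 q2 nu mu; have [Ux _] := Dx.
  apply: (dot x Dx _ _ _ _ _ _ _ _ _ _ (riemE x Dx)) => i j.
    exact: static_sectional_sym.
  by move=> ij; rewrite hayward_sectional_mixed // opprK.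
- move=> x /set_mem /DS Dx q1 q2 nu mu; have [Ux _] := Dx.
  apply: (dot x Dx _ _ _ _ _ _ _ _ _ _ (confE x Dx)) => i j.
    by rewrite static_sectional_sym [static_ricci _ _ _ i _ + _]addrC.
  (* The coefficient is [m B2 / B1^2 + kappa / 12] with [kappa = - 24 b^2 m^2 B2 / B1^3]; the claim
     follows from [B1 - 2 b^2 m = r^3]. *)
  move=> ij; rewrite hayward_sectional_mixed // hayward_ricci_mixed //.
  rewrite hayward_scalar //.
  by rewrite /B1 /B2 /hayward_B2 /hayward_B1; field; rewrite B1_neq0.
- move=> x /set_mem /DS Dx q1 q2 nu mu; have [Ux _] := Dx.
  apply: (dot x Dx _ _ _ _ _ _ _ _ _ _ (concE x Dx)) => i j.
    by rewrite static_sectional_sym.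
  move=> ij; rewrite hayward_sectional_mixed // hayward_scalar //.
  by rewrite /B1 /B2 /hayward_B2 /hayward_B1; field; rewrite B1_neq0.
- move=> x /set_mem /DS Dx q1 q2 nu mu; have [Ux _] := Dx.
  apply: (dot x Dx _ _ _ _ _ _ _ _ _ _ (conhE x Dx)) => i j.
    by rewrite static_sectional_sym [static_ricci _ _ _ i _ + _]addrC.
  (* Now the shift is [kappa / 4], and [B1 - 6 b^2 m = - B2] produces the square of [B2] and the
     opposite sign. *)
  move=> ij; rewrite hayward_sectional_mixed // hayward_ricci_mixed //.
  by rewrite /B1 /B2 /hayward_B2 /hayward_B1; field; rewrite B1_neq0.
- split.
  + exact: (compat _ _ _ _ _ DS riemE).
  + exact: (compat _ _ _ _ _ DS projE).
  + exact: (compat _ _ _ _ _ DS conhE).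
  + exact: (compat _ _ _ _ _ DS concE).
  + exact: (compat _ _ _ _ _ DS confE).
Qed.
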